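(* Every randomized one-pass streaming algorithm that solves the problem GEOM-QUERY-CONV-POLY with probability $1-\rho$ uses $\Omega(n)$ bits of space.
   Context: GEOM-QUERY-CONV-POLY is the following decision problem: a convex polyhedron $\mathcal{C}$ is given as an input stream of at most $n$ hyperplanes in $\mathbb{R}^d$ (each hyperplane stands for the linear constraint, i.e. half-space, that it bounds, and $\mathcal{C}$ is the intersection of these constraints), and a query point $q$ is given at the end of the stream; the task is to detect whether $\mathcal{C}$ contains $q$. A one-pass (insertion-only) streaming algorithm reads the hyperplanes once in order and keeps only a memory state (sketch), whose size in bits is the space used; the query is answered from this state. The parameter $\rho$ is the allowed error probability, typically $\rho=\frac13$.
   Formalization: Proved for error probability 0 ≤ ρ < 1/2 (at ρ ≥ 1/2 a coin flip needs no memory) and dimension d ≥ 2 (at d = 1 the polyhedron is an interval, stored in O(log n) bits when coordinates have O(log n) bits). *)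

(* Defs.v *)
From HB Require Import structures.
From mathcomp Require Import all_boot all_order all_algebra.
From mathcomp Require Import all_classical all_reals all_analysis.

Set Implicit Arguments.
Unset Strict Implicit.
Unset Printing Implicit Defensive.

Import Order.TTheory GRing.Theory Num.Theory.
Local Open Scope classical_set_scope.
Local Open Scope ring_scope.

(* The pair (a, b) is the hyperplane a . x = b. Its orientation is part of the
   data: it bounds the closed half-space a . x <= b, and (- a, - b) is the same
   hyperplane bounding the opposite half-space. *)
Definition hyperplane (R : realType) (d : nat) : Type :=
  {h : 'rV[R]_d * R | h.1 != 0}.

Definition normal (R : realType) (d : nat) (h : hyperplane R d) : 'rV[R]_d :=
  (val h).1.

Definition offset (R : realType) (d : nat) (h : hyperplane R d) : R :=
  (val h).2.

Definition halfspace (R : realType) (d : nat) (h : hyperplane R d) :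
    set 'rV[R]_d :=
  [set x | \sum_(i < d) normal h 0 i * x 0 i <= offset h].

Definition polyhedron (R : realType) (d : nat) (hs : seq (hyperplane R d)) :
    set 'rV[R]_d :=
  \bigcap_(h in [set` hs]) halfspace h.

(* U is the set of numbers allowed as coordinates of the input; U = setT puts no
   restriction on the instance. *)
Definition hyperplane_over (R : realType) (d : nat) (U : set R)
    (h : hyperplane R d) : Prop :=
  (forall i : 'I_d, U (normal h 0 i)) /\ U (offset h).

Definition point_over (R : realType) (d : nat) (U : set R) (q : 'rV[R]_d) :
    Prop :=
  forall i : 'I_d, U (q 0 i).

(* A one-pass algorithm with s bits of memory, reading items of type I and then
   answering one yes/no query of type Q. All its randomness is an outcome w of a
   sample space Omega, which can be read at any time and is not counted as
   memory. Since the position of the item being read is available to the update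
   function, w can also provide fresh coins for each update. *)
Record streaming_algorithm (Omega I Q : Type) (s : nat) := StreamingAlgorithm {
  init : Omega -> s.-tuple bool ;
  update : Omega -> nat -> s.-tuple bool -> I -> s.-tuple bool ;
  answer : Omega -> s.-tuple bool -> Q -> bool
}.

Fixpoint run_from (Omega I Q : Type) (s : nat)
    (A : streaming_algorithm Omega I Q s) (w : Omega) (t : nat)
    (m : s.-tuple bool) (stream : seq I) : s.-tuple bool :=
  if stream is x :: stream' then run_from A w t.+1 (update A w t m x) stream'
  else m.

Definition output (Omega I Q : Type) (s : nat)
    (A : streaming_algorithm Omega I Q s) (w : Omega) (stream : seq I) (q : Q) :
    bool :=
  answer A w (run_from A w 0 (init A w) stream) q.

(* The error bound is required instance by instance; the instance does not
   depend on the random outcome. *)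
Definition solves_geom_query_conv_poly (R : realType) (d n : nat) (U : set R)
    (rho : R) (disp : measure_display) (Omega : measurableType disp)
    (P : probability Omega R) (s : nat)
    (A : streaming_algorithm Omega (hyperplane R d) 'rV[R]_d s) : Prop :=
  forall (hs : seq (hyperplane R d)) (q : 'rV[R]_d),
    (size hs <= n)%N ->
    (forall h, h \in hs -> hyperplane_over U h) ->
    point_over U q ->
    let correct := [set w : Omega | output A w hs q = `[< polyhedron hs q >]] in
    measurable correct /\ ((1 - rho)%:E <= P correct)%E.

(* Main.v *)
Require Import Defs.
From HB Require Import structures.
From mathcomp Require Import all_boot all_order all_algebra.
From mathcomp Require Import all_classical all_reals all_analysis.
From mathcomp Require Import measurable_realfun zify ring lra.

Set Implicit Arguments.
Unset Strict Implicit.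
Unset Printing Implicit Defensive.

Import Order.TTheory GRing.Theory Num.Theory.
Local Open Scope classical_set_scope.
Local Open Scope ring_scope.

(* The one-way INDEX problem reduces to the polyhedron query. A bit vector v is
   encoded as the stream of those lines k with v k = 1, where line k is a slightly
   raised tangent to a parabola that cuts off exactly the k-th of n integer points
   on it; querying the j-th point then reads off bit j. So each random outcome w
   turns the algorithm into an encoding of {0,1}^n by s bits with a decoder, and
   on average over v, w the decoded vector agrees with v in at least
   (1 - rho) n places.
   For x > 0 and fixed memory m, the sum over v of expR (x (agreements -
   disagreements)) is (expR x + expR (- x)) ^ n, so s bits allow at most 2 ^ s
   times that; taking x proportional to 1/2 - rho forces
   s >= (1/2 - rho) ^ 2 n / 2. *)

(** Inverting [1 - x <= expR (- x)] and [1 + x <= expR x] bounds the sum by [2 / (1 - x ^+ 2)],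
    which is at most [2 * (1 + 2 * x ^+ 2)] for such small [x]. *)
Lemma expRDN_le (R : realType) (x : R) :
  0 <= x -> x <= 2^-1 -> expR x + expR (- x) <= 2 * expR (2 * x ^+ 2).
Proof.
move=> x0 x1.
have hx : expR x <= (1 - x)^-1.
  rewrite -[x in expR x]opprK expRN lef_pV2 ?posrE ?expR_gt0 //; last by lra.
  exact: expR_ge1Dx.
have hNx : expR (- x) <= (1 + x)^-1.
  rewrite expRN lef_pV2 ?posrE ?expR_gt0 //; last by lra.
  exact: expR_ge1Dx.
apply: le_trans (lerD hx hNx) _.
apply: le_trans (_ : 2 * (1 + 2 * x ^+ 2) <= _); last first.
  by rewrite ler_pM2l // expR_ge1Dx.
have -> : (1 - x)^-1 + (1 + x)^-1 = 2 / ((1 - x) * (1 + x)).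
  by field; apply/andP; split; apply: lt0r_neq0; lra.
rewrite ler_pdivrMr; last by apply: mulr_gt0; lra.
have x2 : 0 <= x ^+ 2 <= 4^-1 by rewrite sqr_ge0 /=; nra.
nra.
Qed.

Definition agreement n (u v : {ffun 'I_n -> bool}) : nat :=
  \sum_(j < n) (u j == v j).

(** The exponential factors over coordinates, and each factor sums to the same value whichever bit
    [u j] is. *)
Lemma sum_expR_agreement (R : realType) n (x : R) (u : {ffun 'I_n -> bool}) :
  \sum_v expR (x * (2 * (agreement u v)%:R - n%:R)) =
  (expR x + expR (- x)) ^+ n.
Proof.
pose f (j : 'I_n) (b : bool) := expR (x * (2 * (u j == b)%:R - 1)).
have -> : (expR x + expR (- x)) ^+ n = \prod_(j < n) \sum_b f j b.
  rewrite -[in LHS](card_ord n) -prodr_const; apply: eq_bigr => j _.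
  rewrite big_bool /f; case: (u j) => /=.
    by congr (expR _ + expR _); ring.
  by rewrite addrC; congr (expR _ + expR _); ring.
rewrite bigA_distr_bigA; apply: eq_bigr => v _.
rewrite /f -expR_sum; congr expR.
rewrite -mulr_sumr sumrB -mulr_sumr /agreement natr_sum; congr (_ * (_ - _)).
by rewrite sumr_const card_ord.
Qed.

(* The linear bound [1 + u <= expR u], summed over [v], turns the exponential
   moment into a bound on the mean agreement. *)
Lemma sum_agreement_le (R : realType) n (M : finType) (x t : R)
    (enc : {ffun 'I_n -> bool} -> M) (dec : M -> {ffun 'I_n -> bool}) :
  \sum_v (1 + (x * (2 * (agreement (dec (enc v)) v)%:R - n%:R) - t)) <=
  #|M|%:R * (expR (- t) * (expR x + expR (- x)) ^+ n).
Proof.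
pose F m v := expR (x * (2 * (agreement (dec m) v)%:R - n%:R) - t).
(* Summing over every memory state, not only [enc v], removes the dependence on [enc] at the cost of
   the factor [#|M|]. *)
apply: (@le_trans _ _ (\sum_m \sum_v F m v)).
  rewrite exchange_big; apply: ler_sum => v _.
  rewrite (bigD1 (enc v)) //=; apply: le_trans (expR_ge1Dx _) _.
  by rewrite lerDl; apply: sumr_ge0 => m _; exact: expR_ge0.
rewrite le_eqVlt; apply/orP; left; apply/eqP.
rewrite mulr_natl -sumr_const; apply: eq_bigr => m _.
rewrite -(sum_expR_agreement x (dec m)) mulr_sumr.
by apply: eq_bigr => v _; rewrite /F expRD mulrC.
Qed.

(** The left side is the expectation of the sum of indicators, and [P] has total mass 1. *)
Lemma sum_probability_le (R : realType) (disp : measure_display)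
    (Omega : measurableType disp) (P : probability Omega R)
    (I : finType) (E : I -> set Omega) (B : R) :
  (forall i, measurable (E i)) ->
  (forall w, \sum_i \1_(E i) w <= B) ->
  (\sum_i P (E i) <= B%:E)%E.
Proof.
move=> mE hB.
have -> : (\sum_i P (E i) = \int[P]_w (\sum_i (\1_(E i) w)%:E))%E.
  rewrite ge0_integral_sum //.
  - by apply: eq_bigr => i _; rewrite integral_indic // setIT.
  - by move=> i; apply/measurable_EFinP; exact: measurable_indic.
apply: (@le_trans _ _ (\int[P]_w (cst B%:E w))%E); last first.
  by rewrite integral_cst // -[leRHS]mule1 -(probability_setT P).
apply: ge0_le_integral => //.
- by move=> w _; apply: sume_ge0 => i _; rewrite lee_fin.
- by apply: emeasurable_sum => i; apply/measurable_EFinP; exact: measurable_indic.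
- by move=> w _; rewrite sumEFin lee_fin.
Qed.

Lemma index_lower_bound (R : realType) (rho : R) (n s : nat)
    (disp : measure_display) (Omega : measurableType disp)
    (P : probability Omega R)
    (enc : Omega -> {ffun 'I_n -> bool} -> s.-tuple bool)
    (dec : Omega -> s.-tuple bool -> {ffun 'I_n -> bool}) :
  0 <= rho -> rho < 2^-1 ->
  (forall v j, let correct := [set w | dec w (enc w v) j = v j] in
    measurable correct /\ ((1 - rho)%:E <= P correct)%E) ->
  (2^-1 - rho) ^+ 2 / 2 * n%:R <= s%:R.
Proof.
move=> rho0 rho1 hP.
set del := 2^-1 - rho.
have del0 : 0 < del by rewrite /del; lra.
(* Mean agreement at least [(1 - rho) n] makes agreements minus disagreements at least [2 del n] on
   average; [t] is [x] times this. The value [del / 2] minimizes the final exponent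
   [- 2 x del n + 2 x ^ 2 n]. [B] is [sum_agreement_le] solved for the total agreement. *)
pose x := del / 2; pose t := 2 * x * del * n%:R.
pose K := (2 ^ s)%:R * (expR (- t) * (expR x + expR (- x)) ^+ n).
pose N : R := (2 ^ n)%:R.
pose B := (K - N * (1 - x * n%:R - t)) / (2 * x).
have x0 : 0 < x by rewrite /x; lra.
have cardT : #|{: {ffun 'I_n -> bool}}| = (2 ^ n)%N.
  by rewrite card_ffun card_bool card_ord.
pose E (p : {ffun 'I_n -> bool} * 'I_n) :=
  [set w | dec w (enc w p.1) p.2 = p.1 p.2].
have hB w : \sum_p (\1_(E p) w : R) <= B.
  have := @sum_agreement_le R n _ x t (enc w) (dec w).
  rewrite card_tuple card_bool -/K.
  rewrite (eq_bigr (fun v => 2 * x * (agreement (dec w (enc w v)) v)%:R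
                             + (1 - x * n%:R - t))); last by move=> v _; ring.
  rewrite big_split /= -mulr_sumr sumr_const cardT -mulr_natl -/N => h.
  rewrite /B ler_pdivlMr; last by rewrite mulr_gt0.
  have -> : \sum_p (\1_(E p) w : R) = \sum_v (agreement (dec w (enc w v)) v)%:R.
    rewrite -(pair_bigA _ (fun v j => \1_(E (v, j)) w)) /=.
    apply: eq_bigr => v _; rewrite /agreement natr_sum; apply: eq_bigr => j _.
    rewrite indicE /E; congr (_ %:R); congr nat_of_bool.
    by apply/idP/eqP => [/set_mem //|h']; apply/mem_set.
  lra.
have hle := @sum_probability_le R _ _ P _ E B (fun p => (hP p.1 p.2).1) hB.
have {hle} : (\sum_(p : {ffun 'I_n -> bool} * 'I_n) (1 - rho)%:E <= B%:E)%E.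
  by apply: le_trans hle; apply: lee_sum => p _; exact: (hP p.1 p.2).2.
rewrite sumEFin lee_fin sumr_const card_prod cardT card_ord.
rewrite -[leLHS]mulr_natl natrM -/N.
rewrite /B ler_pdivlMr; last by rewrite mulr_gt0.
move=> h.
(* By the choice of [t], the linear terms cancel and only the constant 1 per vector remains. *)
have NK : N <= K.
  suff : N * n%:R * (1 - rho) * (2 * x) = N * (x * n%:R + t) by lra.
  by rewrite /t /del; field.
have N0 : 0 < N by rewrite ltr0n expn_gt0.
have : K <= N * expR (s%:R - del ^+ 2 / 2 * n%:R).
  (* This uses only [2 <= expR 1]. *)
  have hs : (2 ^ s)%:R <= expR s%:R :> R.
    rewrite -[s%:R in leRHS]mulr1 expRM_natl natrX lerXn2r ?nnegrE ?expR_ge0 //.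
    by have := expR_ge1Dx (1 : R); lra.
  have hn : (expR x + expR (- x)) ^+ n <= N * expR (n%:R * (2 * x ^+ 2)).
    rewrite expRM_natl /N natrX -exprMn.
    rewrite lerXn2r ?nnegrE ?addr_ge0 ?mulr_ge0 ?expR_ge0 //.
    by apply: expRDN_le; rewrite /x /del; lra.
  have -> : s%:R - del ^+ 2 / 2 * n%:R
            = s%:R + (- t + n%:R * (2 * x ^+ 2)) by rewrite /t /x; field.
  rewrite /K !expRD [leRHS]mulrCA [N * _]mulrCA.
  by apply: ler_pM hs _ => //; rewrite ler_pM2l ?expR_gt0.
move=> /(le_trans NK); rewrite -[leLHS]mulr1 ler_pM2l // -expR0 ler_expR; lra.
Qed.

Section ParabolaTangents.
Variables (R : realType) (d : nat).

(** Zero padding carries the planar construction to every dimension at least 2. *)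
Definition plane_vector (a b : R) : 'rV[R]_d.+2 :=
  \row_i (if i == 0 then a else if i == 1 then b else 0).

Lemma plane_vector_coord (Q : R -> Prop) (a b : R) :
  Q a -> Q b -> Q 0 -> forall i, Q (plane_vector a b 0 i).
Proof. by move=> Qa Qb Q0 i; rewrite mxE; case: eqP => // _; case: eqP. Qed.

Lemma plane_vector_dot (a b x y : R) :
  \sum_i plane_vector a b 0 i * plane_vector x y 0 i = a * x + b * y.
Proof.
rewrite big_ord_recl big_ord_recl big1 ?addr0 => [|i _]; rewrite !mxE //=.
by rewrite mul0r.
Qed.

Lemma tangent_neq0 (k : nat) :
  plane_vector (2 * k%:R) (- 1) != 0.
Proof.
apply/eqP => /matrixP /(_ 0 1); rewrite !mxE /= => /eqP.
by rewrite oppr_eq0 oner_eq0.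
Qed.

(* The tangent to y = x ^ 2 at x = k, translated upwards by 1: among the integer
   points (j, j ^ 2) it cuts off only the one with j = k, because
   2 k j - j ^ 2 <= k ^ 2 - 1 means 1 <= (j - k) ^ 2. *)
Definition tangent (k : nat) : hyperplane R d.+2 :=
  exist (fun h : 'rV[R]_d.+2 * R => is_true (h.1 != 0))
    (plane_vector (2 * k%:R) (- 1), k%:R ^+ 2 - 1) (tangent_neq0 k).

Definition parabola_point (j : nat) : 'rV[R]_d.+2 :=
  plane_vector j%:R (j%:R ^+ 2).

Lemma halfspace_tangent (k j : nat) :
  halfspace (tangent k) (parabola_point j) <-> k != j.
Proof.
rewrite /halfspace /= /normal /offset /= plane_vector_dot.
(* Over the integers, a square is at least 1 as soon as it is nonzero. *)
have -> : (2 * k%:R * j%:R + - 1 * j%:R ^+ 2 <= k%:R ^+ 2 - 1 :> R) =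
          ((1 : int) <= (k%:Z - j%:Z) ^+ 2).
  rewrite -(ler_int R) rmorphXn rmorphB /= -!pmulrn.
  by apply/idP/idP => ?; lra.
split; first by move=> h; apply/eqP => kj; move: h; rewrite kj subrr expr0n.
move=> kj; have : k%:Z - j%:Z != 0 by rewrite subr_eq0 eqz_nat.
by rewrite -sqrf_eq0 => h; rewrite -gtz0_ge1 lt_neqAle eq_sym h sqr_ge0.
Qed.

(** All entries are integers of absolute value at most [n ^ 2], so the hard instances need only
    O(log n) bits per coordinate. *)
Lemma tangent_over (U : set R) (n k : nat) : (2 <= n)%N -> (k < n)%N ->
  (forall z : int, `|z| <= (n ^ 2)%N%:Z -> U z%:~R) ->
  hyperplane_over U (tangent k).
Proof.
move=> n2 kn hU; split.
  apply: plane_vector_coord.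
  - have -> : 2 * k%:R = (2 * k)%:Z%:~R :> R by rewrite -pmulrn natrM.
    by apply: hU; nia.
  - by have -> : - 1 = (-1)%:~R :> R by []; apply: hU; nia.
  - by apply: (hU 0); nia.
have -> : offset (tangent k) = ((k ^ 2)%:Z - 1)%:~R.
  by rewrite /offset /= rmorphB /= -pmulrn natrX.
by apply: hU; nia.
Qed.

Lemma parabola_point_over (U : set R) (n j : nat) : (j < n)%N ->
  (forall z : int, `|z| <= (n ^ 2)%N%:Z -> U z%:~R) ->
  point_over U (parabola_point j).
Proof.
move=> jn hU; apply: plane_vector_coord.
- by rewrite pmulrn; apply: hU; nia.
- by rewrite -natrX pmulrn; apply: hU; nia.
- by apply: (hU 0); nia.
Qed.

Definition tangents n (v : {ffun 'I_n -> bool}) : seq (hyperplane R d.+2) :=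
  [seq tangent k | k : 'I_n <- enum 'I_n & v k].

(** Only tangent [j] can exclude point [j], and it is in the stream exactly when [v j] holds; hence
    the negation. *)
Lemma polyhedron_tangents n (v : {ffun 'I_n -> bool}) (j : 'I_n) :
  `[< polyhedron (tangents v) (parabola_point j) >] = ~~ v j.
Proof.
apply/asboolP/negP => [h vj | nvj _ /mapP[k hk ->]].
  have /h /halfspace_tangent : [set` tangents v] (tangent j).
    by apply/mapP; exists j; rewrite // mem_filter vj mem_enum.
  by rewrite eqxx.
apply/halfspace_tangent; move: hk; rewrite mem_filter => /andP[vk _].
by apply/eqP => /ord_inj kj; apply: nvj; rewrite -kj.
Qed.

End ParabolaTangents.

Theorem theorem10 (R : realType) (rho : R) (rho_ge0 : 0 <= rho)
    (rho_lt_half : rho < 2^-1) :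
  exists (c : R) (k n0 : nat), 0 < c /\
    forall (n d : nat) (U : set R),
      (n0 <= n)%N -> (2 <= d)%N ->
      (forall z : int, `|z| <= (n ^ k)%N%:Z -> U z%:~R) ->
      forall (disp : measure_display) (Omega : measurableType disp)
        (P : probability Omega R) (s : nat)
        (A : streaming_algorithm Omega (hyperplane R d) 'rV[R]_d s),
        solves_geom_query_conv_poly n U rho P A ->
        c * n%:R <= s%:R.
Proof.
exists ((2^-1 - rho) ^+ 2 / 2), 2%N, 2%N; split.
  by rewrite divr_gt0 // exprn_gt0 // subr_gt0.
move=> n [|[|d]] // U n2 _ hU disp Omega P s A hA.
(* The message in INDEX is the memory state after the whole stream; the decoder asks all [n] queries
   from that one state. *)
pose enc w (v : {ffun 'I_n -> bool}) := run_from A w 0 (init A w) (tangents R d v).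
pose dec w m := [ffun j : 'I_n => ~~ answer A w m (parabola_point R d j)].
apply: (index_lower_bound (enc := enc) (dec := dec)) => // v j.
have -> : [set w | dec w (enc w v) j = v j] =
    [set w | output A w (tangents R d v) (parabola_point R d j) =
             `[< polyhedron (tangents R d v) (parabola_point R d j) >]].
  rewrite polyhedron_tangents; apply/seteqP; split=> w /=; rewrite ffunE.
    by move=> <-; rewrite negbK.
  by rewrite /output -/(enc w v) => ->; rewrite negbK.
apply: hA.
- rewrite size_map size_filter; apply: leq_trans (count_size _ _) _.
  by rewrite size_enum_ord.
- by move=> h /mapP[k _ ->]; exact: tangent_over hU.
- exact: parabola_point_over hU.
Qed.
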